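(* For $\alpha\in\mathbb{N}_0$ and all $n\ge2$, the components $U_n^{\alpha}(x)$ and $V_n^{\alpha}(x)$ of the Sobolev-Laguerre polynomials satisfy the spectral differential equations $$\widetilde{\mathcal{L}}_{2\alpha+8,x}^{\alpha}U_n^{\alpha}(x)=-\lambda_n^{\alpha,B}\,U_n^{\alpha}(x),\qquad \widehat{\mathcal{L}}_{4\alpha+10,x}^{\alpha}V_n^{\alpha}(x)=-\lambda_n^{\alpha,C}\,V_n^{\alpha}(x).$$
   Context: Notation: $\mathbb{N}_0=\{0,1,2,\dots\}$; $D_x^i$ is $i$-fold differentiation with respect to $x$; $(a)_0=1$ and $(a)_n=a(a+1)\cdots(a+n-1)$ is the shifted factorial. The classical Laguerre polynomials are $L_n^{\alpha}(x)=\frac{(\alpha+1)_n}{n!}\,{}_1F_1(-n;\alpha+1;x)$. For $n\ge2$, $$U_n^{\alpha}(x)=\frac{(\alpha+3)_{n-2}}{(\alpha+1)(\alpha+3)(n-2)!}\Big[\frac{x^2}{n-1}L_{n-2}^{\alpha+4}(x)-(\alpha+2)xL_{n-1}^{\alpha+2}(x)-(n+\alpha+1)L_n^{\alpha}(x)\Big],$$ $$V_n^{\alpha}(x)=\frac{1}{\alpha+1}\frac{(\alpha+3)_{n-2}}{(n-1)!}\frac{(\alpha+4)_{n-2}}{n!}x^2L_{n-2}^{\alpha+4}(x),$$ $$\lambda_n^{\alpha,B}=\frac{\alpha+2}{\alpha+1}\frac{(n-2)_{\alpha+4}}{(\alpha+4)!}+\frac{1}{\alpha+1}\frac{(n-1)_{\alpha+3}}{(\alpha+3)!},$$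 $$\lambda_n^{\alpha,C}=\frac{1}{\alpha+1}\sum_{j=0}^{\min(n-2,\alpha+2)}\frac{(\alpha+3-j)_{2j}}{j!(j+1)!}\frac{(n-1-j)_{j+\alpha+3}}{(j+\alpha+3)!}.$$ The differential expressions are $$\widetilde{\mathcal{L}}_{2\alpha+8,x}^{\alpha}y(x)=\frac{(-1)^{\alpha}}{(\alpha+1)(\alpha+4)!}\big[\mathcal{E}_x^{\alpha}+\mathcal{F}_x^{\alpha}+\mathcal{G}_x^{\alpha}\big]y(x),$$ $$\mathcal{E}_x^{\alpha}y(x)=-(\alpha+2)\,e^xx\,D_x^{\alpha+4}\big\{e^{-x}x^2D_x^{\alpha+4}[x^{\alpha+1}y(x)]\big\},$$ $$\mathcal{F}_x^{\alpha}y(x)=(\alpha+4)\,e^xx\,D_x^{\alpha+3}\big\{e^{-x}(x+2\alpha+4)D_x^{\alpha+3}[x^{\alpha+1}y(x)]\big\},$$ $$\mathcal{G}_x^{\alpha}y(x)=(\alpha+1)(\alpha+3)(\alpha+4)\,e^xD_x^{\alpha+2}\big\{e^{-x}(x+2\alpha+4)D_x^{\alpha+2}[x^{\alpha}y(x)]\big\},$$ $$\widehat{\mathcal{L}}_{4\alpha+10,x}^{\alpha}y(x)=\sum_{j=0}^{\alpha+2}\frac{(\alpha+3-j)_{2j}}{j!(j+1)!}\mathcal{H}_x^{\alpha,j}y(x),$$ $$\mathcal{H}_x^{\alpha,j}y(x)=\frac{(-1)^{\alpha+j}}{(\alpha+1)(\alpha+3+j)!}e^xx\,D_x^{\alpha+3+j}\big\{e^{-x}x^j(x+q_j^{\alpha})D_x^{\alpha+3+j}[x^{\alpha+1}y(x)]\big\},\quad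 q_j^{\alpha}=\frac{(\alpha+2-j)(\alpha+3+j)}{\alpha+2}.$$ *)

(* Defs.v *)
From HB Require Import structures.
From mathcomp Require Import all_boot all_order all_algebra.
From mathcomp Require Import all_classical all_reals all_analysis.

Set Implicit Arguments.
Unset Strict Implicit.
Unset Printing Implicit Defensive.

Import Order.TTheory GRing.Theory Num.Theory.
Import numFieldNormedType.Exports.

Local Open Scope ring_scope.

Definition pochhammer (R : realType) (a : R) (n : nat) : R :=
  \prod_(i < n) (a + i%:R).

(* [limn] is total, so this is meaningful when the series converges and no
   (c)_k vanishes; below a = - n, so that the series terminates, and c > 0. *)
Definition hyp1F1 (R : realType) (a c x : R) : R :=
  limn (series (fun k : nat =>
    pochhammer a k / pochhammer c k * (x ^+ k / (k`!)%:R))).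

Definition laguerre (R : realType) (a : R) (n : nat) (x : R) : R :=
  pochhammer (a + 1) n / (n`!)%:R * hyp1F1 (- n%:R) (a + 1) x.

(* The subtractions n - 2 and n - 1 on indices are truncated; compU, compV and
   the eigenvalues are only meant for n >= 2. *)
Definition compU (R : realType) (alpha n : nat) (x : R) : R :=
  pochhammer (alpha%:R + 3) (n - 2)
    / ((alpha%:R + 1) * (alpha%:R + 3) * ((n - 2)`!)%:R)
  * (x ^+ 2 / (n%:R - 1) * laguerre (alpha%:R + 4) (n - 2) x
     - (alpha%:R + 2) * x * laguerre (alpha%:R + 2) (n - 1) x
     - (n%:R + alpha%:R + 1) * laguerre alpha%:R n x).

Definition compV (R : realType) (alpha n : nat) (x : R) : R :=
  1 / (alpha%:R + 1)
  * (pochhammer (alpha%:R + 3) (n - 2) / ((n - 1)`!)%:R)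
  * (pochhammer (alpha%:R + 4) (n - 2) / (n`!)%:R)
  * x ^+ 2 * laguerre (alpha%:R + 4) (n - 2) x.

Definition lambdaB (R : realType) (alpha n : nat) : R :=
  (alpha%:R + 2) / (alpha%:R + 1)
    * (pochhammer (n%:R - 2) (alpha + 4) / ((alpha + 4)`!)%:R)
  + 1 / (alpha%:R + 1)
    * (pochhammer (n%:R - 1) (alpha + 3) / ((alpha + 3)`!)%:R).

Definition lambdaC (R : realType) (alpha n : nat) : R :=
  1 / (alpha%:R + 1)
  * \sum_(j < (minn (n - 2) (alpha + 2)).+1)
      pochhammer (alpha%:R + 3 - j%:R) (2 * j) / (j`! * (j.+1)`!)%:R
      * (pochhammer (n%:R - 1 - j%:R) (j + alpha + 3)
           / ((j + alpha + 3)`!)%:R).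

Definition opE (R : realType) (alpha : nat) (y : R -> R) (x : R) : R :=
  - (alpha%:R + 2) * expR x * x
  * derive1n (alpha + 4) (fun t : R => expR (- t) * t ^+ 2
      * derive1n (alpha + 4) (fun s : R => s ^+ (alpha + 1) * y s) t) x.

Definition opF (R : realType) (alpha : nat) (y : R -> R) (x : R) : R :=
  (alpha%:R + 4) * expR x * x
  * derive1n (alpha + 3) (fun t : R => expR (- t) * (t + 2 * alpha%:R + 4)
      * derive1n (alpha + 3) (fun s : R => s ^+ (alpha + 1) * y s) t) x.

Definition opG (R : realType) (alpha : nat) (y : R -> R) (x : R) : R :=
  (alpha%:R + 1) * (alpha%:R + 3) * (alpha%:R + 4) * expR x
  * derive1n (alpha + 2) (fun t : R => expR (- t) * (t + 2 * alpha%:R + 4)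
      * derive1n (alpha + 2) (fun s : R => s ^+ alpha * y s) t) x.

Definition Ltilde (R : realType) (alpha : nat) (y : R -> R) (x : R) : R :=
  (-1) ^+ alpha / ((alpha%:R + 1) * ((alpha + 4)`!)%:R)
  * (opE alpha y x + opF alpha y x + opG alpha y x).

Definition qcoef (R : realType) (alpha j : nat) : R :=
  (alpha%:R + 2 - j%:R) * (alpha%:R + 3 + j%:R) / (alpha%:R + 2).

Definition opH (R : realType) (alpha j : nat) (y : R -> R) (x : R) : R :=
  (-1) ^+ (alpha + j) / ((alpha%:R + 1) * ((alpha + 3 + j)`!)%:R)
  * expR x * x
  * derive1n (alpha + 3 + j)
      (fun t : R => expR (- t) * t ^+ j * (t + qcoef R alpha j)
        * derive1n (alpha + 3 + j)
            (fun s : R => s ^+ (alpha + 1) * y s) t) x.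

Definition Lhat (R : realType) (alpha : nat) (y : R -> R) (x : R) : R :=
  \sum_(j < (alpha + 2).+1)
    pochhammer (alpha%:R + 3 - j%:R) (2 * j) / (j`! * (j.+1)`!)%:R
    * opH alpha j y x.

(* Main.v *)
Require Import Defs.
From mathcomp Require Import all_boot all_order all_algebra.
From mathcomp Require Import all_classical all_reals all_analysis.
From mathcomp Require Import ring lra zify.
Import Order.TTheory GRing.Theory Num.Theory.
Import numFieldNormedType.Exports.
Local Open Scope ring_scope.

(** Since [e^x D^m (e^-x q) = (D - 1)^m q], both differential expressions map
    polynomials to polynomials, and everything reduces to their matrices in
    the basis of monomials.  Each expression is a sum of sandwiches
    [(D - 1)^m x^r D^m x^s], possibly followed by multiplication by [x], with
    [m = s + r + c]; such a sandwich sends [x^k] to a combination of the [x^l]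
    whose coefficients are products of factorials and reciprocals of
    factorials ([coef_sandwich]).  With the convention [1/z! = 0] for negative
    integers [z], the recursion [1/(z-1)! = z * 1/z!] holds for all integers
    ([rfact_pred]), so that identities between such products come down to
    identities between rational functions, without boundary cases.

    First equation.  Up to a factor, [U_n] has the coefficients
    [(-1)^k coefU k].  The coefficient of [x^l] in the image of [U_n] is, up to
    the sign and this factor, the sum over [k] of [coefU k * kernelU k l], whose
    rational factor has [(k + alpha + 1) (k + alpha + 2)] in the denominator.
    Subtracting the difference of the explicit sequence [certU] removes this
    denominator and leaves two Vandermonde convolutions ([kernelU_telescope]).
    Their closed forms are the two terms of [lambdaB].

    Second equation.  Let [T] be the Laguerre operator conjugated by [x^2],
      [T = x^2 (x D^2 + (alpha + 5 - x) D) x^-2],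
    so that [T x^k = (k - 2) (k + alpha + 2) x^(k-1) - (k - 2) x^k] and [V_n]
    is an eigenvector of [T] for the eigenvalue [-(n - 2)].  The operator
    [Lhat] commutes with [T] on the multiples of [x^2] ([kernelV_commute]):
    each matrix entry of the commutator is a sum over [j] of an explicit
    difference [certV j.+1 - certV j].  The image of [V_n] is therefore again
    an eigenvector of [T] for [-(n - 2)].  The operator [T] is triangular with
    distinct diagonal entries [-(k - 2)], so this eigenvector is a multiple of
    [V_n], and the factor is the diagonal entry [- kernelV n n] of [Lhat]
    ([imageV_eigen]), which is [- lambdaC] term by term. *)

Set Implicit Arguments.
Unset Strict Implicit.
Unset Printing Implicit Defensive.

(** * Reciprocal factorials of integers *)

Definition rfact (R : realType) (z : int) : R :=
  if z is Posz n then (n`!)%:R^-1 else 0.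

Arguments rfact : simpl never.

Section Rfact.
Variable R : realType.
Notation rf := (@rfact R).

Lemma factr_neq0 n : (n`!)%:R != 0 :> R.
Proof. by rewrite pnatr_eq0 -lt0n fact_gt0. Qed.

Lemma factrS n : (n.+1`!)%:R = n.+1%:R * (n`!)%:R :> R.
Proof. by rewrite factS natrM. Qed.

Lemma rfact_nat (n : nat) : rf n = (n`!)%:R^-1. Proof. by []. Qed.

Lemma rfact_neg z : z < 0 -> rf z = 0. Proof. by case: z. Qed.

Lemma rfact_pred z z' : z' = z - 1 -> rf z' = z%:~R * rf z.
Proof.
move=> ->; case: z => [[|n]|n].
- by rewrite mul0r.
- rewrite (_ : n.+1%:Z - 1 = n); last by lia.
  rewrite !rfact_nat factrS invfM mulrA mulfV ?mul1r //.
  by rewrite pnatr_eq0.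
- by rewrite [rf (Negz n)]rfact_neg // mulr0 rfact_neg //; lia.
Qed.

Lemma ffact_rfact n m : (n ^_ m)%:R = (n`!)%:R * rf (n%:Z - m%:Z).
Proof.
case: (leqP m n) => h; last by rewrite ffact_small // rfact_neg ?mulr0 //; lia.
rewrite subzn // rfact_nat -(ffact_fact h) natrM mulfK // ?factr_neq0.
Qed.

(** Vandermonde's convolution of the binomial coefficients of [n - i] and of
    [b].  The induction on [b] is Pascal's rule for the last two factors; it
    has no boundary cases because [l] ranges over all integers. *)
Lemma vandermonde_rfact (n i : nat) (b : nat) (l : int) : (i <= n)%N ->
  \sum_(k < n.+1) rf (n%:Z - k%:Z) * rf (k%:Z - i%:Z) * rf (k%:Z - l)
    * rf (b%:Z - k%:Z + l) =
  (n - i + b)`!%:R * rf (n%:Z - i%:Z) * rf b * rf (n%:Z - l) * rf (b%:Z + l - i%:Z).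
Proof.
move=> le_in; elim: b l => [|b IH] l.
  rewrite addn0 (subzn le_in) [rf (n - i)%N]rfact_nat.
  case: (ltP l 0) => [l0|l0].
    rewrite big1 => [|k _]; last first.
      by rewrite (@rfact_neg (0%N%:Z - k%:Z + l)) ?mulr0 //; lia.
    by rewrite (@rfact_neg (0%N%:Z + l - i%:Z)) ?mulr0 //; lia.
  case: l l0 => // l _.
  case: (leqP l n) => [ln|ln]; last first.
    rewrite big1 => [|k _].
      by rewrite (@rfact_neg (n%:Z - l%:Z)) ?(mulr0, mul0r) //; lia.
    rewrite (@rfact_neg (k%:Z - l%:Z)) ?(mulr0, mul0r) //.
    by have := ltn_ord k; lia.
  have ln' : (l < n.+1)%N by [].
  rewrite (bigD1 (Ordinal ln')) //= big1 => [|k /eqP kl]; last first.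
    have : (k < l)%N \/ (l < k)%N.
      case: (ltngtP k l) => [||kl']; [by left|by right|].
      by case: kl; apply/val_inj.
    case=> h.
      by rewrite (@rfact_neg (k%:Z - l%:Z)) ?(mulr0, mul0r) //; lia.
    by rewrite (@rfact_neg (0%N%:Z - k%:Z + l%:Z)) ?(mulr0, mul0r) //; lia.
  rewrite addr0.
  have -> : 0%N%:Z - l%:Z + l%:Z = 0%N by lia.
  have -> : l%:Z - l%:Z = 0%N by lia.
  rewrite !rfact_nat fact0 invr1 !mulr1.
  have -> : 0%N%:Z + l%:Z - i%:Z = l%:Z - i%:Z by lia.
  rewrite mulfV ?factr_neq0 //; ring.
apply: (@mulfI R b.+1%:R); first by rewrite pnatr_eq0.
rewrite mulr_sumr.
under eq_bigr => k _.
  have -> : b.+1%:R * (rf (n%:Z - k%:Z) * rf (k%:Z - i%:Z) * rf (k%:Z - l)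
        * rf (b.+1%:Z - k%:Z + l))
    = rf (n%:Z - k%:Z) * rf (k%:Z - i%:Z) * rf (k%:Z - l) * rf (b%:Z - k%:Z + l)
    + rf (n%:Z - k%:Z) * rf (k%:Z - i%:Z) * rf (k%:Z - (l + 1))
      * rf (b%:Z - k%:Z + (l + 1)).
    rewrite (@rfact_pred (k%:Z - l) (k%:Z - (l + 1))); last by lia.
    rewrite (@rfact_pred (b.+1%:Z - k%:Z + l) (b%:Z - k%:Z + l)); last by lia.
    have -> : b%:Z - k%:Z + (l + 1) = b.+1%:Z - k%:Z + l by lia.
    ring.
  over.
rewrite big_split /= !IH addnS factrS.
rewrite (@rfact_pred b.+1%:Z b%:Z); last by lia.
rewrite (@rfact_pred (b.+1%:Z + l - i%:Z) (b%:Z + l - i%:Z)); last by lia.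
have -> : b%:Z + (l + 1) - i%:Z = b.+1%:Z + l - i%:Z by lia.
rewrite (@rfact_pred (n%:Z - l) (n%:Z - (l + 1))); last by lia.
have -> : (n - i + b).+1%:R = n%:R - i%:R + b%:R + 1 :> R by rewrite -addn1 !natrD natrB.
ring.
Qed.

End Rfact.

(** Discharges the side conditions of [field]: sums of nonnegative terms and
    a positive constant, factorials, or hypotheses. *)
Ltac neq0 := repeat (apply/andP; split);
  first [assumption | exact: factr_neq0 | apply: lt0r_neq0; lra].

(** * The differential expressions as operators on polynomials *)
Section Operators.
Variable R : realType.
Notation rf := (@rfact R).

(** The conjugate of the derivation by [e^-x]: [e^x D (e^-x p) = D p - p]. *)
Definition expderiv (p : {poly R}) := p^`() - p.

Definition sandwich_poly (s r c : nat) (P : {poly R}) : {poly R} :=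
  iter (s + r + c) expderiv ('X^r * ('X^s * P)^`(s + r + c)).

(** The coefficient of [x^l] in [sandwich_poly s r c 'X^k], up to the sign.  The
    exponent [l] is an integer, so that multiplication by [x] amounts to
    replacing [l] by [l - 1]. *)
Definition sandwich_entry (s r c k : nat) (l : int) : R :=
  ((k + s)`!)%:R * rf (k%:Z - (r + c)%N%:Z) * ((s + r + c)`!)%:R
  * ((k - c)`!)%:R * rf l * rf (k%:Z - c%:Z - l)
  * rf ((s + r + c)%N%:Z - k%:Z + c%:Z + l).

Lemma derive1n_horner (p : {poly R}) m : derive1n m (horner p) = horner p^`(m).
Proof. by elim: m => [|m IH] //; rewrite derive1nS IH -derivE derivnS. Qed.

Lemma derive1n_expR_horner (q : {poly R}) (f : R -> R) m x :
  (forall t, f t = expR (- t) * q.[t]) ->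
  expR x * derive1n m f x = (iter m expderiv q).[x].
Proof.
move=> fE; suff -> : derive1n m f = fun t => expR (- t) * (iter m expderiv q).[t].
  by rewrite mulrA -expRD subrr expR0 mul1r.
elim: m => [|m IH]; first exact/funext.
rewrite derive1nS IH; apply/funext => t.
rewrite derive1E /= /expderiv hornerD hornerN.
set Q := iter m _ _.
have -> : (fun t : R => expR (- t) * Q.[t]) = (expR \o -%R) * horner Q by [].
apply: derive_val.
apply: is_derive_eq.
by rewrite /GRing.scale /=; ring.
Qed.

Lemma derive1n_monomial_horner s (P : {poly R}) m :
  derive1n m (fun t : R => t ^+ s * P.[t]) = horner ('X^s * P)^`(m).
Proof.
rewrite -derive1n_horner; congr derive1n.
by apply/funext => t; rewrite hornerM hornerXn.
Qed.

Lemma sandwich_horner s r c m P f x : m = (s + r + c)%N ->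
  (forall t, f t = expR (- t) * t ^+ r * derive1n m (fun t : R => t ^+ s * P.[t]) t) ->
  expR x * derive1n m f x = (sandwich_poly s r c P).[x].
Proof.
move=> -> fE; apply: derive1n_expR_horner => t.
by rewrite fE derive1n_monomial_horner hornerM hornerXn mulrA.
Qed.

Lemma iter_expderivDZ (c : R) p q m :
  iter m expderiv (p + c *: q) = iter m expderiv p + c *: iter m expderiv q.
Proof.
elim: m => [|m IH] //=; rewrite IH /expderiv derivD derivZ scalerBr opprD.
by rewrite addrACA.
Qed.

(** The weights [e^-t t^r (t + q)] of the differential expressions split into
    two sandwiches of the same order, with [c = 1] and [c = 2]. *)
Lemma sandwich_affine_horner s r q m P f x : m = (s + r.+1 + 1)%N ->
  (forall t, f t = expR (- t) * t ^+ r * (t + q)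
                   * derive1n m (fun t : R => t ^+ s * P.[t]) t) ->
  expR x * derive1n m f x = (sandwich_poly s r.+1 1 P + q *: sandwich_poly s r 2 P).[x].
Proof.
move=> -> fE; rewrite /sandwich_poly.
rewrite (_ : (s + r + 2 = s + r.+1 + 1)%N); last by lia.
rewrite -iter_expderivDZ; apply: derive1n_expR_horner => t.
rewrite fE derive1n_monomial_horner hornerD hornerZ !hornerM !hornerXn exprS.
ring.
Qed.

Lemma Ltilde_horner alpha (P : {poly R}) x :
  Ltilde alpha (horner P) x =
  ((-1) ^+ alpha / ((alpha%:R + 1) * ((alpha + 4)`!)%:R) *:
   (- (alpha%:R + 2) *: ('X * sandwich_poly (alpha + 1) 2 1 P)
    + (alpha%:R + 4) *: ('X * sandwich_poly (alpha + 1) 1 1 P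
        + (2 * alpha%:R + 4) *: ('X * sandwich_poly (alpha + 1) 0 2 P))
    + ((alpha%:R + 1) * (alpha%:R + 3) * (alpha%:R + 4)) *:
      (sandwich_poly alpha 1 1 P + (2 * alpha%:R + 4) *: sandwich_poly alpha 0 2 P))).[x].
Proof.
rewrite /Ltilde hornerZ !hornerD !hornerZ !hornerD !hornerZ; congr (_ * (_ + _ + _)).
- rewrite /opE -2!mulrA; congr (_ * _).
  rewrite mulrCA (@sandwich_horner (alpha + 1) 2 1 (alpha + 4) P) ?hornerM ?hornerX //.
  by lia.
- rewrite /opF -!mulrA; congr (_ * _); rewrite mulrCA.
  rewrite (@sandwich_affine_horner (alpha + 1) 0 (2 * alpha%:R + 4) (alpha + 3) P).
  + by rewrite !(hornerD, hornerM, hornerZ, hornerX); ring.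
  + by lia.
  + by move=> t; rewrite expr0 mulr1 -addrA.
- rewrite /opG -[_ * expR x * _]mulrA; congr (_ * _).
  rewrite (@sandwich_affine_horner alpha 0 (2 * alpha%:R + 4) (alpha + 2) P).
  + by rewrite hornerD hornerZ.
  + by lia.
  + by move=> t; rewrite expr0 mulr1 -addrA.
Qed.

Lemma opH_horner alpha j (P : {poly R}) x :
  opH alpha j (horner P) x =
  ((-1) ^+ (alpha + j) / ((alpha%:R + 1) * ((alpha + 3 + j)`!)%:R) *:
   ('X * sandwich_poly (alpha + 1) j.+1 1 P
     + qcoef R alpha j *: ('X * sandwich_poly (alpha + 1) j 2 P))).[x].
Proof.
rewrite /opH hornerZ -!(mulrA (_ / _)); congr (_ * _); rewrite mulrAC mulrC.
rewrite (@sandwich_affine_horner (alpha + 1) j (qcoef R alpha j) (alpha + 3 + j) P) //.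
  by rewrite !(hornerD, hornerM, hornerZ, hornerX); ring.
by lia.
Qed.

(** * Matrices in the basis of monomials *)

Lemma sign_parity (n m : nat) : odd n = odd m -> (-1) ^+ n = (-1) ^+ m :> R.
Proof. by move=> h; rewrite -signr_odd h signr_odd. Qed.

Lemma sign_cases m : (-1) ^+ m = 1 :> R \/ (-1) ^+ m = -1 :> R.
Proof. by rewrite -signr_odd; case: odd; [right|left]. Qed.

Lemma coef_monomials n (u : nat -> R) l : (forall k, (n <= k)%N -> u k = 0) ->
  (\sum_(k < n) u k *: 'X^k)`_l = u l.
Proof.
move=> u0; rewrite -poly_def coef_poly; case: ltnP => // /u0 -> //.
Qed.

Lemma horner_monomials n (u : nat -> R) x :
  (\sum_(k < n) u k *: 'X^k).[x] = \sum_(k < n) u k * x ^+ k.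
Proof. by rewrite horner_sum; apply: eq_bigr => k _; rewrite hornerZ hornerXn. Qed.

Lemma iter_expderiv_sum n (c : nat -> R) (q : nat -> {poly R}) m :
  iter m expderiv (\sum_(k < n) c k *: q k) = \sum_(k < n) c k *: iter m expderiv (q k).
Proof.
elim: m => [|m IH] //=; rewrite IH /expderiv (raddf_sum (@deriv R)) -sumrB.
by apply: eq_bigr => k _ /=; rewrite derivZ scalerBr.
Qed.

(** The binomial expansion of [(D - 1)^m x^e]. *)
Lemma coef_iter_expderivXn m e l :
  (iter m expderiv 'X^e)`_l = (-1) ^+ (m + e + l) * (m`!)%:R * (e`!)%:R
    * rf l * rf (e%:Z - l%:Z) * rf (m%:Z - e%:Z + l%:Z).
Proof.
elim: m l => [|m IH] l.
  rewrite /= coefXn; case: eqVneq => [->|ne].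
    have -> : e%:Z - e%:Z = 0%N by lia.
    have -> : 0%N%:Z - e%:Z + e%:Z = 0%N by lia.
    rewrite !rfact_nat fact0 invr1 !mulr1 -mulrA mulfV ?factr_neq0 // mulr1.
    by rewrite add0n addnn -signr_odd odd_double.
  case: (ltnP l e) => h.
    by rewrite [rf (0%N%:Z - _ + _)]rfact_neg ?mulr0 //; lia.
  by rewrite [rf (e%:Z - _)]rfact_neg ?(mulr0, mul0r) //; lia.
rewrite /= /expderiv coefB coef_deriv !IH -mulr_natl factrS.
rewrite (@rfact_pred _ l.+1 l); last by lia.
rewrite (@rfact_pred _ (e%:Z - l%:Z) (e%:Z - l.+1%:Z)); last by lia.
rewrite (@rfact_pred _ (m.+1%:Z - e%:Z + l%:Z) (m%:Z - e%:Z + l%:Z)); last by lia.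
have -> : m%:Z - e%:Z + l.+1%:Z = m.+1%:Z - e%:Z + l%:Z by lia.
by rewrite addnS !addSn !exprS; ring.
Qed.

Lemma coef_sandwich n (u : nat -> R) s r c l :
  (sandwich_poly s r c (\sum_(k < n) u k *: 'X^k))`_l
  = \sum_(k < n) (-1) ^+ (k + l + s + r) * u k * sandwich_entry s r c k l.
Proof.
rewrite /sandwich_poly.
have -> : 'X^r * ('X^s * \sum_(k < n) u k *: 'X^k)^`(s + r + c)
    = \sum_(k < n) (u k * ((k + s)`!)%:R * rf (k%:Z - (r + c)%N%:Z)) *: 'X^(k - c).
  rewrite mulr_sumr raddf_sum mulr_sumr; apply: eq_bigr => k _.
  rewrite /= -scalerAr derivnZ -scalerAr -exprD derivnXn -[in LHS]scaler_nat.
  rewrite -scalerAr -exprD scalerA ffact_rfact.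
  have -> : (s + k)%N%:Z - (s + r + c)%N%:Z = k%:Z - (r + c)%N%:Z by lia.
  rewrite mulrA addnC; case: (leqP (r + c) k) => h.
    by congr (_ *: 'X^_); lia.
  by rewrite rfact_neg ?mulr0 ?scale0r //; lia.
rewrite (iter_expderiv_sum n (fun k => u k * ((k + s)`!)%:R * rf (k%:Z - (r + c)%N%:Z))
  (fun k => 'X^(k - c))) coef_sum; apply: eq_bigr => k _.
rewrite coefZ coef_iter_expderivXn /sandwich_entry.
case: (leqP c k) => h; last by rewrite [rf (k%:Z - _)]rfact_neg ?(mulr0, mul0r) //; lia.
rewrite -subzn //.
have -> : (s + r + c)%N%:Z - (k%:Z - c%:Z) + l%:Z
    = (s + r + c)%N%:Z - k%:Z + c%:Z + l%:Z by lia.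
rewrite (@sign_parity (s + r + c + (k - c) + l) (k + l + s + r)); last by congr odd; lia.
ring.
Qed.

Lemma coef_X_sandwich n (u : nat -> R) s r c l :
  ('X * sandwich_poly s r c (\sum_(k < n) u k *: 'X^k))`_l
  = \sum_(k < n) - (-1) ^+ (k + l + s + r) * u k * sandwich_entry s r c k (l%:Z - 1).
Proof.
rewrite coefXM; case: l => [|l] /=.
  rewrite big1 // => k _.
  by rewrite /sandwich_entry (@rfact_neg _ (0%N%:Z - 1)) // !(mulr0, mul0r).
rewrite coef_sandwich; apply: eq_bigr => k _.
by rewrite (_ : l.+1%:Z - 1 = l); [rewrite addnS !addSn exprS mulN1r opprK|lia].
Qed.

End Operators.

(** * Expansion of the Laguerre polynomials *)
Section Laguerre.
Variable R : realType.
Notation rf := (@rfact R).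

Lemma pochhammerS (x : R) m : pochhammer x m.+1 = pochhammer x m * (x + m%:R).
Proof. by rewrite /pochhammer big_ord_recr. Qed.

(** Covers the case [z = 0 < m] as well, where both sides vanish. *)
Lemma pochhammer_rfact (x : R) (z : int) m k :
  x = z%:~R -> 0 <= z -> z + m%:Z = k%:Z + 1 ->
  pochhammer x m = (k`!)%:R * rf (z - 1).
Proof.
move=> -> z0; elim: m k => [|m IH] k zm.
  rewrite /pochhammer big_ord0 (_ : z - 1 = k%:Z); last by lia.
  by rewrite rfact_nat mulfV // factr_neq0.
rewrite pochhammerS; case: k zm => [|k] zm.
  have -> : z = 0 by lia.
  have -> : m = 0%N by lia.
  by rewrite addr0 mulr0 [rf _]rfact_neg ?mulr0.
rewrite (IH k); last by lia.
rewrite factrS (_ : k.+1%:R = z%:~R + m%:R); first by ring.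
have -> : z = k%:Z + 1 - m%:Z by lia.
ring.
Qed.

Lemma pochhammer_opp n k :
  pochhammer (- n%:R : R) k = (-1) ^+ k * (n`!)%:R * rf (n%:Z - k%:Z).
Proof.
elim: k => [|k IH].
  by rewrite /pochhammer big_ord0 subr0 rfact_nat mul1r mulfV // factr_neq0.
rewrite pochhammerS IH (@rfact_pred _ (n%:Z - k%:Z) (n%:Z - k.+1%:Z)); last by lia.
by rewrite exprS; ring.
Qed.

Lemma laguerre_expand b n (x : R) :
  laguerre b%:R n x = \sum_(k < n.+1) (-1) ^+ k * ((n + b)`!)%:R
    * rf (n%:Z - k%:Z) * rf (b + k)%N * rf k * x ^+ k.
Proof.
pose f k : R := pochhammer (- n%:R) k / pochhammer (b%:R + 1) k * (x ^+ k / (k`!)%:R).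
have -> : laguerre b%:R n x =
    pochhammer (b%:R + 1) n / (n`!)%:R * \sum_(k < n.+1) f k.
  rewrite /laguerre /hyp1F1 -/f; congr (_ * _).
  apply: lim_near_cst; first exact: norm_hausdorff.
  exists n.+1 => // N /= nN; rewrite /series /= (big_cat_nat (n := n.+1)) //=.
  rewrite [X in _ + X]big_nat_cond [X in _ + X]big1 ?addr0 ?big_mkord //.
  move=> k; rewrite andbT => /andP[nk _].
  by rewrite /f pochhammer_opp [rf _]rfact_neg ?(mulr0, mul0r) //; lia.
rewrite mulr_sumr; apply: eq_bigr => k _; rewrite /f.
have P m : pochhammer (b%:R + 1 : R) m = ((b + m)`!)%:R / (b`!)%:R.
  rewrite (@pochhammer_rfact _ (b%:Z + 1) m (b + m)) //; [|ring|lia].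
  by rewrite addrK rfact_nat.
rewrite pochhammer_opp !P !rfact_nat (addnC n b).
field; by neq0.
Qed.

(** The reciprocal factorials vanish for [k < i] and [k > n], so that all three
    terms of [U_n] become sums over the same range. *)
Lemma laguerre_shift b n i (x : R) : (i <= n)%N ->
  x ^+ i * laguerre b%:R (n - i) x = \sum_(k < n.+1) (-1) ^+ (k + i)
    * ((n - i + b)`!)%:R * rf (n%:Z - k%:Z) * rf (b%:Z + k%:Z - i%:Z)
    * rf (k%:Z - i%:Z) * x ^+ k.
Proof.
move=> le_in; rewrite laguerre_expand mulr_sumr.
pose F (k : nat) : R := (-1) ^+ (k + i)
    * ((n - i + b)`!)%:R * rf (n%:Z - k%:Z) * rf (b%:Z + k%:Z - i%:Z)
    * rf (k%:Z - i%:Z) * x ^+ k.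
rewrite -[RHS](big_mkord xpredT F) (big_cat_nat (n := i)) //=; last by lia.
rewrite [X in _ = X + _]big_nat_cond [X in _ = X + _]big1 ?add0r; last first.
  move=> k; rewrite andbT => /andP[_ ki].
  by rewrite /F [rf (k%:Z - _)]rfact_neg ?(mulr0, mul0r) //; lia.
rewrite -[X in \sum_(X <= _ < _) _]add0n big_addn subSn // big_mkord.
apply: eq_bigr => k _.
rewrite /F -addnA addnn exprD -mul2n exprM sqrrN !expr1n mulr1 (exprD x).
have -> : n%:Z - (k + i)%N%:Z = (n - i)%N%:Z - k%:Z by lia.
have -> : b%:Z + (k + i)%N%:Z - i%:Z = (b + k)%N by lia.
have -> : (k + i)%N%:Z - i%:Z = k by lia.
ring.
Qed.

End Laguerre.

(** * The first equation *)
Section FirstEquation.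
Variable R : realType.
Notation rf := (@rfact R).
Notation sw := (@sandwich_entry R).
Variables (alpha n : nat).
Hypothesis n2 : (2 <= n)%N.
Notation a := (alpha%:R : R).
Notation N := (n%:R : R).

Definition scaleU : R := pochhammer (a + 3) (n - 2)
    / ((a + 1) * (a + 3) * ((n - 2)`!)%:R) * ((n + alpha + 1)`!)%:R / (N - 1).

Definition coefU (k : nat) : R :=
  (k%:R - 1) * (k%:R * (N * (a + 2) + 1) + (N - 1) * (a + 1) * (a + 2))
  * rf (n%:Z - k%:Z) * rf k * rf (k + alpha + 2)%N.

Lemma compU_horner : compU alpha n =
  horner (\sum_(k < n.+1) (scaleU * (-1) ^+ k * coefU k) *: 'X^k).
Proof.
apply/funext => x.
rewrite (@horner_monomials R n.+1 (fun k => scaleU * (-1) ^+ k * coefU k)) /compU.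
have -> : alpha%:R + 4 = (alpha + 4)%:R :> R by ring.
have -> : alpha%:R + 2 = (alpha + 2)%:R :> R by ring.
have e0 := @laguerre_shift R alpha n 0 x (leq0n n); rewrite mul1r {1}subn0 in e0.
have e1 := @laguerre_shift R (alpha + 2) n 1 x (ltnW n2); rewrite expr1 in e1.
have e2 := @laguerre_shift R (alpha + 4) n 2 x n2.
rewrite e0 -[_ * x * _]mulrA e1 [_ / _ * laguerre _ _ _]mulrAC e2.
rewrite !(mulr_suml, mulr_sumr) -!sumrB mulr_sumr; apply: eq_bigr => k _.
have n0 : 2 <= N by rewrite (ler_nat _ 2).
have k0 : 0 <= k%:R :> R := ler0n _ _.
have a0 : 0 <= a := ler0n _ _.
rewrite /scaleU /coefU.
have -> : (n - 2 + (alpha + 4) = (n + alpha).+2)%N by lia.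
have -> : (n - 1 + (alpha + 2) = (n + alpha).+1)%N by lia.
have -> : (n - 0 + alpha = n + alpha)%N by lia.
have -> : (n + alpha + 1 = (n + alpha).+1)%N by lia.
rewrite !factrS -[(n + alpha).+2%:R]natr1 -[(n + alpha).+1%:R]natr1 natrD.
set P := (k + alpha + 2)%N.
rewrite (_ : (alpha + 4)%N%:Z + k%:Z - 2%:Z = P); last by lia.
rewrite (@rfact_pred _ P ((alpha + 2)%N%:Z + k%:Z - 1%:Z)); last by lia.
rewrite (@rfact_pred _ (P%:Z - 1) (alpha%:Z + k%:Z - 0%N%:Z)); last by lia.
rewrite (@rfact_pred _ P (P%:Z - 1)); last by lia.
rewrite (@rfact_pred _ (k%:Z - 1%:Z) (k%:Z - 2%:Z)); last by lia.
rewrite (@rfact_pred _ k (k%:Z - 1%:Z)); last by lia.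
have -> : k%:Z - 0%N%:Z = k by lia.
have -> : P%:~R = k%:R + a + 2 :> R by rewrite /P; ring.
have -> : (P%:Z - 1)%:~R = k%:R + a + 1 :> R by rewrite /P; ring.
rewrite addn0 addn1 addn2 !exprS.
field; neq0.
Qed.

(** Up to the sign [(-1)^(k+l)], the coefficient of [x^l] in [Ltilde x^k]. *)
Definition kernelU (k : nat) (l : nat) : R :=
  (- (a + 2) * sw (alpha + 1) 2 1 k (l%:Z - 1)
   + (a + 4) * (- sw (alpha + 1) 1 1 k (l%:Z - 1)
                + (2 * a + 4) * sw (alpha + 1) 0 2 k (l%:Z - 1))
   + (a + 1) * (a + 3) * (a + 4)
     * (- sw alpha 1 1 k l + (2 * a + 4) * sw alpha 0 2 k l))
  / ((a + 1) * ((alpha + 4)`!)%:R).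

(** A rational multiple, with denominator [k + alpha + 1], of the common
    product of reciprocal factorials in [kernelU_telescope]; the
    numerator is such that subtracting [certU k.+1 - certU k] cancels the
    poles of the summand at [k = - (alpha + 1)] and [k = - (alpha + 2)]. *)
Definition certU (l k : nat) : R :=
  (a + 1) * (a + 2) * (l%:R - 1) / ((l%:R + a + 2) * (k%:R + a + 1))
  * rf (n%:Z - k%:Z) * rf (k%:Z - 3%:Z) * rf (k%:Z - l%:Z - 2)
  * rf ((alpha + 4)%N%:Z - k%:Z + l%:Z).

(** The two products of reciprocal factorials on the right are the summands of
    Vandermonde convolutions; they correspond to the two terms of the
    eigenvalue. *)
Lemma kernelU_telescope k l :
  coefU k * kernelU k l = rf l / (a + 1) *
   (- (l%:R - 1) * (l%:R * (N * (a + 2) + 1) + (N - 1) * (a + 1) * (a + 2))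
      / (l%:R + a + 2)
    * ((a + 2) * (rf (n%:Z - k%:Z) * rf (k%:Z - 3%:Z) * rf (k%:Z - l%:Z)
                   * rf ((alpha + 4)%N%:Z - k%:Z + l%:Z))
       + rf (n%:Z - k%:Z) * rf (k%:Z - 2%:Z) * rf (k%:Z - l%:Z)
                   * rf ((alpha + 3)%N%:Z - k%:Z + l%:Z))
    + (certU l k.+1 - certU l k)).
Proof.
case: (ltnP k 2) => [k2|].
  rewrite /coefU /kernelU /certU /sandwich_entry.
  have Z c : (1 < c)%N -> rf (k%:Z - c%:Z) = 0 by move=> c1; rewrite rfact_neg //; lia.
  have Z3 : rf (k.+1%:Z - 3%:Z) = 0 by rewrite rfact_neg //; lia.
  rewrite Z3 !(Z 3%N) //.
  by rewrite !(mulr0, mul0r, addr0, oppr0).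
case: k => [|[|K]] // _.
rewrite /coefU /kernelU /certU /sandwich_entry.
have k0 : 0 <= K%:R :> R := ler0n _ _.
have a0 : 0 <= a := ler0n _ _.
have l0 : 0 <= l%:R :> R := ler0n _ _.
(* All factorials are expressed through their values at common arguments,
   which leaves an identity between rational functions. *)
set A0 := rf (n%:Z - K.+2%:Z).
set B0 := rf (K.+2%:Z - l%:Z).
set C0 := rf ((alpha + 4)%N%:Z - K.+2%:Z + l%:Z).
set F0 := (K`!)%:R^-1 : R.
set M0 := ((alpha + 2)`!)%:R : R.
set P0 := ((K + alpha + 2)`!)%:R : R.
have -> : rf (n%:Z - K.+3%:Z) = (N - K%:R - 2) * A0.
  by rewrite /A0 (@rfact_pred R (n%:Z - K.+2%:Z)); [congr (_ * _); ring|lia].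
have -> : rf (K.+2%:Z - 3%:Z) = K%:R * F0.
  by rewrite (@rfact_pred R K) //; lia.
have -> : rf (K.+3%:Z - 3%:Z) = F0 by rewrite (_ : _ - _ = K%:Z) //; lia.
have -> : rf K.+2 = F0 / ((K%:R + 2) * (K%:R + 1)).
  rewrite rfact_nat !factrS /F0; field.
  by neq0.
have -> : rf (K.+2 + alpha + 2)%N = (P0 * (K%:R + a + 3) * (K%:R + a + 4))^-1.
  rewrite rfact_nat (_ : (K.+2 + alpha + 2 = (K + alpha + 2).+2)%N); last by lia.
  rewrite !factrS -/P0; congr (_^-1); ring.
have -> : ((K.+2 + (alpha + 1))`!)%:R = (K%:R + a + 3) * P0.
  rewrite (_ : (K.+2 + (alpha + 1) = (K + alpha + 2).+1)%N); last by lia.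
  rewrite !factrS -/P0; congr (_ * _); ring.
have -> : ((K.+2 + alpha)`!)%:R = P0.
  by rewrite (_ : (K.+2 + alpha = K + alpha + 2)%N) //; lia.
have -> : (alpha + 1 + 2 + 1 = alpha + 4)%N by lia.
have -> : (alpha + 1 + 1 + 1 = alpha + 3)%N by lia.
have -> : (alpha + 1 + 0 + 2 = alpha + 3)%N by lia.
have -> : (alpha + 1 + 1 = alpha + 2)%N by lia.
have -> : (alpha + 0 + 2 = alpha + 2)%N by lia.
have -> : ((alpha + 4)`!)%:R = (a + 4) * (a + 3) * M0.
  rewrite (_ : (alpha + 4 = (alpha + 2).+2)%N) ?factrS; last by lia.
  rewrite -/M0; ring.
have -> : ((alpha + 3)`!)%:R = (a + 3) * M0.
  rewrite (_ : (alpha + 3 = (alpha + 2).+1)%N) ?factrS; last by lia.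
  rewrite -/M0; ring.
rewrite -/M0.
have -> : (K.+2 - 1 = K.+1)%N by lia.
have -> : (K.+2 - 2 = K)%N by lia.
rewrite factrS.
have F0E : (K`!)%:R = F0^-1 by rewrite invrK.
rewrite F0E.
have -> : rf (l%:Z - 1) = l%:R * rf l by rewrite (@rfact_pred R l).
have rB0 z : z = K.+2%:Z - l%:Z -> rf z = B0 by move=> ->.
have rB1 z : z = K.+2%:Z - l%:Z - 1 -> rf z = (K%:R + 2 - l%:R) * B0.
  by move=> /rfact_pred ->; congr (_ * _); ring.
have rB2 z : z = K.+2%:Z - l%:Z - 2 -> rf z = (K%:R + 1 - l%:R) * (K%:R + 2 - l%:R) * B0.
  move=> zE; rewrite (@rfact_pred R (K.+2%:Z - l%:Z - 1)); last by lia.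
  by rewrite (rB1 (K.+2%:Z - l%:Z - 1)) // mulrA; congr (_ * _ * _); ring.
have rC0 z : z = (alpha + 4)%N%:Z - K.+2%:Z + l%:Z -> rf z = C0 by move=> ->.
have rC1 z : z = (alpha + 4)%N%:Z - K.+2%:Z + l%:Z - 1 ->
    rf z = (a + 2 - K%:R + l%:R) * C0.
  by move=> /rfact_pred ->; congr (_ * _); ring.
rewrite (rB0 (K.+2%:Z - 1%:Z - (l%:Z - 1))); last by lia.
rewrite (rB1 (K.+2%:Z - 2%:Z - (l%:Z - 1))); last by lia.
rewrite (rB1 (K.+2%:Z - 1%:Z - l%:Z)); last by lia.
rewrite (rB2 (K.+2%:Z - 2%:Z - l%:Z)); last by lia.
rewrite (rB1 (K.+3%:Z - l%:Z - 2)); last by lia.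
rewrite (rB2 (K.+2%:Z - l%:Z - 2)); last by lia.
rewrite (rC0 ((alpha + 4)%N%:Z - K.+2%:Z + 1%:Z + (l%:Z - 1))); last by lia.
rewrite (rC1 ((alpha + 3)%N%:Z - K.+2%:Z + 1%:Z + (l%:Z - 1))); last by lia.
rewrite (rC0 ((alpha + 3)%N%:Z - K.+2%:Z + 2%:Z + (l%:Z - 1))); last by lia.
rewrite (rC1 ((alpha + 2)%N%:Z - K.+2%:Z + 1%:Z + l%:Z)); last by lia.
rewrite (rC0 ((alpha + 2)%N%:Z - K.+2%:Z + 2%:Z + l%:Z)); last by lia.
rewrite (rC1 ((alpha + 4)%N%:Z - K.+3%:Z + l%:Z)); last by lia.
rewrite (rC1 ((alpha + 3)%N%:Z - K.+2%:Z + l%:Z)); last by lia.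
have nF : F0 != 0 by rewrite invr_eq0 factr_neq0.
have nM : M0 != 0 by exact: factr_neq0.
have nP : P0 != 0 by exact: factr_neq0.
move: (rf l) A0 B0 C0 F0 M0 P0 nF nM nP {F0E rB0 rB1 rB2 rC0 rC1}.
move=> L0 A0 B0 C0 F0 M0 P0 nF nM nP.
field; neq0.
Qed.

Lemma imageU_eigen l :
  \sum_(k < n.+1) coefU k * kernelU k l
  = - lambdaB R alpha n * coefU l.
Proof.
under eq_bigr => k _ do rewrite kernelU_telescope.
rewrite -mulr_sumr big_split /=.
rewrite -(big_mkord xpredT (fun k => certU l k.+1 - certU l k)).
rewrite telescope_sumr // /certU.
rewrite (@rfact_neg R (n%:Z - n.+1%:Z)); last by lia.
rewrite (@rfact_neg R (0%N%:Z - 3%:Z)) // !(mulr0, mul0r) subrr addr0.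
rewrite -mulr_sumr big_split /= -mulr_sumr.
rewrite (@vandermonde_rfact R n 2 (alpha + 3) l n2).
set S3 := \sum_(k < _) _.
have -> : S3 = ((n + alpha + 1)`!)%:R * rf (n%:Z - 3%:Z) * rf (alpha + 4)%N
    * rf (n%:Z - l%:Z) * rf (l%:Z + alpha%:Z + 1).
  (* For [n = 2] both sides vanish. *)
  case: (leqP 3 n) => n3.
    rewrite /S3 (@vandermonde_rfact R n 3 (alpha + 4) l n3).
    by congr (_`!%:R * _ * _ * _ * rf _); lia.
  rewrite (@rfact_neg R (n%:Z - 3%:Z)); last by lia.
  rewrite !(mulr0, mul0r) /S3 big1 // => k _.
  rewrite (@rfact_neg R (k%:Z - 3%:Z)) ?(mulr0, mul0r) //.
  by have := ltn_ord k; lia.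
rewrite /lambdaB.
rewrite (@pochhammer_rfact R _ (n%:Z - 2) _ (n + alpha + 1)); [|ring|lia|lia].
rewrite (@pochhammer_rfact R _ (n%:Z - 1) _ (n + alpha + 1)); [|ring|lia|lia].
rewrite (_ : n%:Z - 2 - 1 = n%:Z - 3%:Z); last by lia.
rewrite (_ : n%:Z - 1 - 1 = n%:Z - 2%:Z); last by lia.
rewrite (_ : (alpha + 3)%N%:Z + l%:Z - 2%:Z = l%:Z + alpha%:Z + 1); last by lia.
rewrite (_ : (n - 2 + (alpha + 3) = n + alpha + 1)%N); last by lia.
rewrite (@rfact_pred _ (l + alpha + 2)%N (l%:Z + alpha%:Z + 1)); last by lia.
rewrite /coefU !rfact_nat (_ : (alpha + 4 = (alpha + 3).+1)%N) ?factrS; last by lia.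
have l0 : 0 <= l%:R :> R := ler0n _ _.
have a0 : 0 <= a := ler0n _ _.
have -> : (l + alpha + 2)%N%:~R = l%:R + a + 2 :> R by ring.
have -> : (alpha + 3).+1%:R = a + 4 :> R by ring.
field; neq0.
Qed.

Lemma Ltilde_compU x :
  Ltilde alpha (compU alpha n) x = - lambdaB R alpha n * compU alpha n x.
Proof.
have a0 : 0 <= a := ler0n _ _.
rewrite compU_horner Ltilde_horner -hornerZ; congr (_.[x]).
apply/polyP => l.
set u := fun k : nat => scaleU * (-1) ^+ k * coefU k.
rewrite !(coefZ, coefD) !(coef_X_sandwich _ u) !(coef_sandwich _ u).
rewrite (@coef_monomials R _ u) => [|k nk]; last first.
  by rewrite /u /coefU [rf (n%:Z - _)]rfact_neg ?(mulr0, mul0r) //; lia.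
rewrite /u.
transitivity ((-1) ^+ l * scaleU
  * (- lambdaB R alpha n * coefU l)); last by ring.
rewrite -imageU_eigen // !mulr_sumr -!big_split /=.
rewrite !mulr_sumr -!big_split /= !mulr_sumr.
apply: eq_bigr => k _.
rewrite /kernelU !exprD.
case: (sign_cases R alpha) => ->; case: (sign_cases R k) => ->; field;
  neq0.
Qed.

End FirstEquation.

(** * The second equation *)
Section SecondEquation.
Variable R : realType.
Notation rf := (@rfact R).
Notation sw := (@sandwich_entry R).
Variables (alpha n : nat).
Notation a := (alpha%:R : R).
Notation N := (n%:R : R).

Definition weightV (j : nat) : R :=
  ((alpha + 2 + j)`!)%:R * rf ((alpha + 2)%N%:Z - j%:Z) * rf j * rf j.+1.

Lemma weightVE j : (j < alpha + 3)%N ->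
  pochhammer (a + 3 - j%:R) (2 * j) / (j`! * (j.+1)`!)%:R = weightV j.
Proof.
move=> jA.
rewrite (@pochhammer_rfact R _ (alpha%:Z + 3 - j%:Z) _ (alpha + 2 + j)) //;
  [|ring|lia|lia].
rewrite /weightV (_ : alpha%:Z + 3 - j%:Z - 1 = (alpha + 2)%N%:Z - j%:Z); last by lia.
by rewrite natrM invfM -!rfact_nat !mulrA.
Qed.

(** Up to the sign [- (-1)^(k+l)], the coefficient of [x^l] in the [j]-th term
    of [Lhat x^k]. *)
Definition termV (j k : nat) (l : nat) : R :=
  weightV j / ((a + 1) * ((alpha + 3 + j)`!)%:R)
  * (sw (alpha + 1) j.+1 1 k (l%:Z - 1)
     - qcoef R alpha j * sw (alpha + 1) j 2 k (l%:Z - 1)).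

Definition kernelV (k l : nat) : R := \sum_(j < alpha + 3) termV j k l.

Lemma termV_small j k l : (k < l)%N -> termV j k l = 0.
Proof.
move=> kl; rewrite /termV /sandwich_entry.
rewrite (@rfact_neg R (k%:Z - 1%:Z - (l%:Z - 1))); last by lia.
rewrite (@rfact_neg R (k%:Z - 2%:Z - (l%:Z - 1))); last by lia.
by rewrite !(mulr0, mul0r) subrr mulr0.
Qed.

Lemma kernelV_small k l : (k < l)%N -> kernelV k l = 0.
Proof. by move=> kl; rewrite /kernelV big1 // => j _; rewrite termV_small. Qed.

(** Gosper's antidifference in [j] of the commutator entry of
    [termV_telescope].  It vanishes at both ends of the range of summation, for
    [j = 0] through [1/(j-1)!] and for [j = alpha + 3] through
    [1/(alpha+2-j)!]. *)
Definition certV (K l j : nat) : R :=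
  ((K + alpha + 2)`!)%:R * (K`!)%:R / ((a + 1) * (a + 2))
  * ((alpha + 2 + j)`!)%:R * rf ((alpha + 2)%N%:Z - j%:Z) * rf (j%:Z - 1) * rf j
  * rf (K%:Z - j%:Z) * rf l * rf (K.+1%:Z - l%:Z)
  * rf ((alpha + 2 + j)%N%:Z - K%:Z + l%:Z)
  * (l%:R * (K%:R - j%:R) - (K%:R + 1) * (K%:R + a + 3)).

(** The left-hand side is, up to the sign, the contribution of the [j]-th term
    to the coefficient of [x^l] in [(Lhat T - T Lhat) x^(K+2)]. *)
Lemma termV_telescope K l j :
  K%:R * (K%:R + a + 4) * termV j K.+1 l + (K%:R + 2 - l%:R) * termV j K.+2 l
  - (l%:R - 1) * (l%:R + a + 3) * termV j K.+2 l.+1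
  = certV K l j.+1 - certV K l j.
Proof.
rewrite /termV /weightV /certV /sandwich_entry /qcoef.
have k0 : 0 <= K%:R :> R := ler0n _ _.
have a0 : 0 <= a := ler0n _ _.
have j0 : 0 <= j%:R :> R := ler0n _ _.
(* All factorials are expressed through their values at common arguments,
   which leaves an identity between rational functions. *)
set A0 := rf ((alpha + 2)%N%:Z - j%:Z).
set B0 := rf (K.+2%:Z - l%:Z).
set C0 := rf ((alpha + 3 + j)%N%:Z - K%:Z + l%:Z).
set D0 := rf (K%:Z - j%:Z).
set F0 := (j`!)%:R^-1 : R.
set M0 := ((alpha + 2 + j)`!)%:R : R.
set P0 := ((K + alpha + 2)`!)%:R : R.
have rA1 z : z = (alpha + 2)%N%:Z - j%:Z - 1 -> rf z = (a + 2 - j%:R) * A0.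
  by move=> /rfact_pred ->; congr (_ * _); ring.
have rB0 z : z = K.+2%:Z - l%:Z -> rf z = B0 by move=> ->.
have rB1 z : z = K.+2%:Z - l%:Z - 1 -> rf z = (K%:R + 2 - l%:R) * B0.
  by move=> /rfact_pred ->; congr (_ * _); ring.
have rB2 z : z = K.+2%:Z - l%:Z - 2 -> rf z = (K%:R + 1 - l%:R) * (K%:R + 2 - l%:R) * B0.
  move=> zE; rewrite (@rfact_pred R (K.+2%:Z - l%:Z - 1)); last by lia.
  by rewrite (rB1 (K.+2%:Z - l%:Z - 1)) // mulrA; congr (_ * _ * _); ring.
have rC0 z : z = (alpha + 3 + j)%N%:Z - K%:Z + l%:Z -> rf z = C0 by move=> ->.
have rC1 z : z = (alpha + 3 + j)%N%:Z - K%:Z + l%:Z - 1 ->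
    rf z = (a + 3 + j%:R - K%:R + l%:R) * C0.
  by move=> /rfact_pred ->; congr (_ * _); ring.
have rC2 z : z = (alpha + 3 + j)%N%:Z - K%:Z + l%:Z - 2 ->
    rf z = (a + 2 + j%:R - K%:R + l%:R) * (a + 3 + j%:R - K%:R + l%:R) * C0.
  move=> zE.
  rewrite (@rfact_pred R ((alpha + 3 + j)%N%:Z - K%:Z + l%:Z - 1)); last by lia.
  by rewrite rC1 // mulrA; congr (_ * _ * _); ring.
have rD0 z : z = K%:Z - j%:Z -> rf z = D0 by move=> ->.
have rD1 z : z = K%:Z - j%:Z - 1 -> rf z = (K%:R - j%:R) * D0.
  by move=> /rfact_pred ->; congr (_ * _); ring.
have rD1' (K' : nat) : rf (K'%:Z - j%:Z - 1) = (K'%:R - j%:R) * rf (K'%:Z - j%:Z).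
  by rewrite (@rfact_pred R (K'%:Z - j%:Z)) //; congr (_ * _); ring.
have rj : rf j = F0 by [].
have rj1 : rf j.+1 = F0 / (j%:R + 1).
  rewrite rfact_nat !factrS /F0; field; by neq0.
have rjm1 : rf (j%:Z - 1) = j%:R * F0 by rewrite (@rfact_pred R j).
have rjm0 : rf (j.+1%:Z - 1) = F0 by rewrite (_ : _ - _ = j%:Z) //; lia.
rewrite rjm1 rjm0 rj1 rj.
have -> : rf (l%:Z - 1) = l%:R * rf l by rewrite (@rfact_pred R l).
have -> : rf (l.+1%:Z - 1) = rf l by congr rf; lia.
rewrite (rA1 ((alpha + 2)%N%:Z - j.+1%:Z)); last by lia.
have eM : (alpha + 1 + j.+1 + 1 = alpha + 3 + j)%N by lia.
have eM' : (alpha + 1 + j + 2 = alpha + 3 + j)%N by lia.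
rewrite eM eM'.
have eM1 : ((alpha + 3 + j)`!)%:R = (a + j%:R + 3) * M0.
  rewrite (_ : (alpha + 3 + j = (alpha + 2 + j).+1)%N) ?factrS -/M0; last by lia.
  by congr (_ * _); ring.
have eM2 : ((alpha + 2 + j.+1)`!)%:R = (a + j%:R + 3) * M0.
  by rewrite (_ : (alpha + 2 + j.+1 = alpha + 3 + j)%N) ?eM1 //; lia.
rewrite eM1 eM2.
have -> : ((K.+1 + (alpha + 1))`!)%:R = P0.
  by rewrite (_ : (K.+1 + (alpha + 1) = K + alpha + 2)%N) //; lia.
have -> : ((K.+2 + (alpha + 1))`!)%:R = (K%:R + a + 3) * P0.
  rewrite (_ : (K.+2 + (alpha + 1) = (K + alpha + 2).+1)%N) ?factrS -/P0; last by lia.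
  by congr (_ * _); ring.
have -> : (K.+2 - 1 = K.+1)%N by lia.
have -> : (K.+2 - 2 = K)%N by lia.
have -> : (K.+1 - 1 = K)%N by lia.
set T0 := ((K.+1 - 2)`!)%:R : R.
rewrite (rD1 (K.+1%:Z - (j.+1 + 1)%N%:Z)); last by lia.
rewrite (rD1 (K.+1%:Z - (j + 2)%N%:Z)); last by lia.
rewrite (rD0 (K.+2%:Z - (j.+1 + 1)%N%:Z)); last by lia.
rewrite (rD0 (K.+2%:Z - (j + 2)%N%:Z)); last by lia.
rewrite (rD1 (K%:Z - j.+1%:Z)); last by lia.
(* The truncated subtraction in [T0] gives [T0 = (K - 1)!] only for [0 < K];
   for [K = 0] the factor [(K - j) / (K - j)!] vanishes. *)
have hT : K%:R * T0 * ((K%:R - j%:R) * D0) = (K`!)%:R * ((K%:R - j%:R) * D0).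
  rewrite /T0 /D0; case: (K) => [|K']; last by rewrite subSS subn1 /= factrS.
  rewrite -rD1' //.
  by rewrite [rf (0%N%:Z - j%:Z - 1)]rfact_neg ?mulr0 //; lia.
move: hT; set D1 := (K%:R - j%:R) * D0 => hT.
have e0 := rB1 (K.+1%:Z - 1%:Z - (l%:Z - 1)) ltac:(lia).
have e1 := rB2 (K.+1%:Z - 2%:Z - (l%:Z - 1)) ltac:(lia).
have e2 := rC1 ((alpha + 3 + j)%N%:Z - K.+1%:Z + 1%:Z + (l%:Z - 1)) ltac:(lia).
have e3 := rC0 ((alpha + 3 + j)%N%:Z - K.+1%:Z + 2%:Z + (l%:Z - 1)) ltac:(lia).
have e4 := rB0 (K.+2%:Z - 1%:Z - (l%:Z - 1)) ltac:(lia).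
have e5 := rC2 ((alpha + 3 + j)%N%:Z - K.+2%:Z + 1%:Z + (l%:Z - 1)) ltac:(lia).
have e6 := rB1 (K.+2%:Z - 2%:Z - (l%:Z - 1)) ltac:(lia).
have e7 := rC1 ((alpha + 3 + j)%N%:Z - K.+2%:Z + 2%:Z + (l%:Z - 1)) ltac:(lia).
have e8 := rB1 (K.+2%:Z - 1%:Z - (l.+1%:Z - 1)) ltac:(lia).
have e9 := rC1 ((alpha + 3 + j)%N%:Z - K.+2%:Z + 1%:Z + (l.+1%:Z - 1)) ltac:(lia).
have e10 := rB2 (K.+2%:Z - 2%:Z - (l.+1%:Z - 1)) ltac:(lia).
have e11 := rC0 ((alpha + 3 + j)%N%:Z - K.+2%:Z + 2%:Z + (l.+1%:Z - 1)) ltac:(lia).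
have e12 := rB1 (K.+1%:Z - l%:Z) ltac:(lia).
have e13 := rC0 ((alpha + 2 + j.+1)%N%:Z - K%:Z + l%:Z) ltac:(lia).
have e14 := rC1 ((alpha + 2 + j)%N%:Z - K%:Z + l%:Z) ltac:(lia).
rewrite ?e0 ?e1 ?e2 ?e3 ?e4 ?e5 ?e6 ?e7 ?e8 ?e9 ?e10 ?e11 ?e12 ?e13 ?e14.
have K00 : D1 != 0 -> K%:R != 0 :> R.
  apply: contraNneq => K0; move: hT; rewrite K0 !mul0r => /esym/eqP.
  by rewrite mulf_eq0 (negbTE (factr_neq0 _ _)).
move: hT K00; rewrite /D1 {D1}.
have nM : M0 != 0 by exact: factr_neq0.
have nP : P0 != 0 by exact: factr_neq0.
have nK : (K`!)%:R != 0 :> R by exact: factr_neq0.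
rewrite factrS -[K.+1%:R]natr1.
clear rj rj1 rjm1 rjm0 eM eM' eM1 eM2 rA1 rB0 rB1 rB2 rC0 rC1 rC2 rD0 rD1 rD1'.
clear e0 e1 e2 e3 e4 e5 e6 e7 e8 e9 e10 e11 e12 e13 e14.
move: (rf l) A0 B0 C0 D0 F0 M0 P0 T0 (K`!)%:R nM nP nK.
move=> L0 A0 B0 C0 D0 F0 M0 P0 T0 K0 nM nP nK.
have [/eqP|nD] := eqVneq ((K%:R - j%:R) * D0) 0.
  rewrite mulf_eq0 => /orP[|] /eqP D00 _ _.
    have -> : K%:R = j%:R :> R by apply/eqP; rewrite -subr_eq0 D00.
    field; neq0.
  rewrite D00; ring.
move=> /(mulIf nD) hT /(_ isT) Kn.
have -> : T0 = K0 / K%:R by rewrite -hT; field.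
field; by neq0.
Qed.

(** The commutation of [Lhat] with [T] on the multiples of [x^2]. *)
Lemma kernelV_commute K l :
  K%:R * (K%:R + a + 4) * kernelV K.+1 l + (K%:R + 2 - l%:R) * kernelV K.+2 l
  - (l%:R - 1) * (l%:R + a + 3) * kernelV K.+2 l.+1 = 0.
Proof.
rewrite /kernelV !mulr_sumr -big_split -sumrB /=.
under eq_bigr => j _ do rewrite termV_telescope.
rewrite -(big_mkord xpredT (fun j => certV K l j.+1 - certV K l j)).
rewrite telescope_sumr // /certV.
rewrite [rf ((alpha + 2)%N%:Z - _)]rfact_neg; last by lia.
rewrite [rf (0%N%:Z - 1)]rfact_neg; last by lia.
by rewrite !(mulr0, mul0r) subrr.
Qed.

Definition coefV (k : nat) : R :=
  rf (n%:Z - k%:Z) * rf (alpha + 2 + k)%N * rf (k%:Z - 2).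

(** The eigenvector equation for [T], coefficient by coefficient. *)
Lemma coefV_rec k : (k%:R - 1) * (k%:R + a + 3) * coefV k.+1 = (N - k%:R) * coefV k.
Proof.
rewrite /coefV (@rfact_pred _ (n%:Z - k%:Z) (n%:Z - k.+1%:Z)); last by lia.
rewrite (@rfact_pred _ (k.+1%:Z - 2) (k%:Z - 2)); last by lia.
rewrite (@rfact_pred _ (alpha + 2 + k.+1)%N (alpha + 2 + k)%N); last by lia.
ring.
Qed.

Definition imageV (l : nat) : R := \sum_(k < n.+1) coefV k * kernelV k l.

(** Commutation transports the recursion [coefV_rec] to the image. *)
Lemma imageV_rec l : (N - l%:R) * imageV l = (l%:R - 1) * (l%:R + a + 3) * imageV l.+1.
Proof.
pose t (k : nat) : R := (k%:R - 2) * (k%:R + a + 2).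
have shift : \sum_(k < n.+1) coefV k * (t k * kernelV k.-1 l)
    = \sum_(k < n.+1) (N - k%:R) * coefV k * kernelV k l.
  rewrite big_ord_recl [RHS]big_ord_recr /= subrr !mul0r addr0.
  rewrite {1}/coefV [rf (0%N%:Z - 2)]rfact_neg // mulr0 mul0r add0r.
  apply: eq_bigr => k _; rewrite -coefV_rec /bump /= add1n /t; ring.
apply/eqP; rewrite -subr_eq0; apply/eqP.
rewrite /imageV.
transitivity (\sum_(k < n.+1) coefV k * (t k * kernelV k.-1 l
    + (k%:R - l%:R) * kernelV k l - (l%:R - 1) * (l%:R + a + 3) * kernelV k l.+1)).
  under [RHS]eq_bigr => k _ do rewrite mulrBr mulrDr.
  rewrite sumrB big_split /= shift !mulr_sumr -big_split /= -!sumrB.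
  by apply: eq_bigr => k _; ring.
rewrite big1 // => -[[|[|K]] Kn] _ /=.
- by rewrite /coefV [rf (0%N%:Z - 2)]rfact_neg // mulr0 mul0r.
- by rewrite /coefV [rf (1%N%:Z - 2)]rfact_neg // mulr0 mul0r.
have := kernelV_commute K l.
rewrite (_ : t K.+2 = K%:R * (K%:R + a + 4)); last by rewrite /t; ring.
rewrite (_ : K.+2%:R = K%:R + 2); last by ring.
by move=> ->; rewrite mulr0.
Qed.

Hypothesis n2 : (2 <= n)%N.

(** The terms with [n - 2 < j] vanish, which is the truncation of the range of
    summation in [lambdaC]. *)
Lemma kernelV_diag : kernelV n n = lambdaC R alpha n.
Proof.
pose F (j : nat) : R := pochhammer (a + 3 - j%:R) (2 * j) / (j`! * (j.+1)`!)%:R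
      * (pochhammer (N - 1 - j%:R) (j + alpha + 3) / ((j + alpha + 3)`!)%:R).
rewrite /lambdaC -/(F _) (big_ord_widen (alpha + 3) F); last by lia.
rewrite big_mkcond mulr_sumr; apply: eq_bigr => j _ /=.
have k0 : 0 <= N :> R := ler0n _ _.
have a0 : 0 <= a := ler0n _ _.
rewrite /termV /sandwich_entry.
rewrite (@rfact_neg R (n%:Z - 2%:Z - (n%:Z - 1))); last by lia.
rewrite (_ : n%:Z - 1%:Z - (n%:Z - 1) = 0%N); last by lia.
rewrite (_ : (alpha + 1 + j.+1 + 1 = alpha + 3 + j)%N); last by lia.
rewrite (_ : (alpha + 3 + j)%N%:Z - n%:Z + 1%:Z + (n%:Z - 1) = (alpha + 3 + j)%N);
  last by lia.
rewrite (_ : n%:Z - 1 = (n - 1)%N); last by lia.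
rewrite !rfact_nat fact0 invr1 !(mulr0, mul0r) subr0.
case: ifP => jn; last first.
  by rewrite [rf (n%:Z - _)]rfact_neg ?(mulr0, mul0r) //; have := ltn_ord j; lia.
rewrite /F weightVE; last by have := ltn_ord j; lia.
rewrite (@pochhammer_rfact R _ (n%:Z - 1 - j%:Z) _ (n + alpha + 1)); [|ring|lia|lia].
rewrite (_ : n%:Z - 1 - j%:Z - 1 = n%:Z - (j.+1 + 1)%N%:Z); last by lia.
rewrite (_ : (j + alpha + 3 = alpha + 3 + j)%N); last by lia.
rewrite (_ : (n + (alpha + 1) = n + alpha + 1)%N); last by lia.
field; neq0.
Qed.

(** Downward from [l = n], since the factor [n - l] of [imageV_rec] vanishes
    there. *)
Lemma imageV_eigen l : imageV l = lambdaC R alpha n * coefV l.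
Proof.
have [d] := ubnP (n - l); elim: d l => // d IH l ld.
case: (ltngtP l n) => [ln|nl|->].
- have nl0 : N - l%:R != 0 by rewrite subr_eq0 eqr_nat; lia.
  apply: (mulfI nl0); rewrite imageV_rec IH; last by lia.
  by rewrite mulrCA coefV_rec mulrCA.
- rewrite /coefV [rf (n%:Z - _)]rfact_neg ?mul0r ?mulr0; last by lia.
  rewrite /imageV big1 // => k _; rewrite kernelV_small ?mulr0 //.
  by have := ltn_ord k; lia.
rewrite /imageV big_ord_recr /= big1 => [|k _]; last by rewrite kernelV_small ?mulr0.
by rewrite add0r kernelV_diag mulrC.
Qed.

Definition scaleV : R := 1 / (a + 1)
  * (pochhammer (a + 3) (n - 2) / ((n - 1)`!)%:R)
  * (pochhammer (a + 4) (n - 2) / (n`!)%:R) * ((n + alpha + 2)`!)%:R.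

Lemma compV_horner : compV alpha n =
  horner (\sum_(k < n.+1) (scaleV * (-1) ^+ k * coefV k) *: 'X^k).
Proof.
apply/funext => x.
rewrite (@horner_monomials R n.+1 (fun k => scaleV * (-1) ^+ k * coefV k)) /compV.
have -> : alpha%:R + 4 = (alpha + 4)%:R :> R by ring.
rewrite -mulrA (@laguerre_shift R (alpha + 4) n 2 x n2) mulr_sumr.
apply: eq_bigr => k _; rewrite /scaleV /coefV.
have -> : (n - 2 + (alpha + 4) = n + alpha + 2)%N by lia.
have -> : (alpha + 4)%N%:Z + k%:Z - 2%:Z = (alpha + 2 + k)%N by lia.
have -> : alpha%:R + 4 = (alpha + 4)%:R :> R by ring.
by rewrite addn2 !exprS; ring.
Qed.

Lemma Lhat_compV x :
  Lhat alpha (compV alpha n) x = - lambdaC R alpha n * compV alpha n x.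
Proof.
have a0 : 0 <= a := ler0n _ _.
rewrite compV_horner -hornerZ /Lhat.
under eq_bigr => j _ do rewrite opH_horner -hornerZ.
rewrite -horner_sum; congr (_.[x]); apply/polyP => l.
set u := fun k : nat => scaleV * (-1) ^+ k * coefV k.
rewrite coefZ (@coef_monomials R _ u) => [|k nk]; last first.
  by rewrite /u /coefV [rf (n%:Z - _)]rfact_neg ?(mulr0, mul0r) //; lia.
transitivity (- (-1) ^+ l * scaleV
    * (lambdaC R alpha n * coefV l)); last by rewrite /u; ring.
rewrite -imageV_eigen // /imageV /kernelV mulr_sumr.
under [RHS]eq_bigr => k _ do rewrite mulrA mulr_sumr.
rewrite exchange_big coef_sum /= -addnS; apply: eq_bigr => j _.
rewrite !(coefZ, coefD) !(coef_X_sandwich _ u).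
rewrite mulr_sumr -big_split !mulr_sumr; apply: eq_bigr => k _ /=.
rewrite weightVE; last by have := ltn_ord j; lia.
rewrite /termV /u !exprD !exprS.
case: (sign_cases R alpha) => ->; case: (sign_cases R k) => ->;
  case: (sign_cases R j) => ->; field; neq0.
Qed.

End SecondEquation.

Theorem proposition2p3 (R : realType) (alpha n : nat) (hn : (2 <= n)%N) :
  (forall x : R,
     Ltilde alpha (compU alpha n) x = - lambdaB R alpha n * compU alpha n x)
  /\
  (forall x : R,
     Lhat alpha (compV alpha n) x = - lambdaC R alpha n * compV alpha n x).
Proof. by split=> x; [exact: Ltilde_compU|exact: Lhat_compV]. Qed.
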